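(* Let $X$, $Y$ be Banach spaces and let $\Omega$ be a completely regular space. If the pair $(X,Y)$ has the generalized AHSP and $\mathcal{L}(X,\mathcal{C}_b(\Omega,Y))=\mathcal{K}(X,\mathcal{C}_b(\Omega,Y))$, then the pair $(X, \mathcal{C}_b(\Omega,Y))$ has the generalized AHSP. Equivalently, if the pair $(\ell_1(X),Y)$ has the BPBp and $\mathcal{L}(X,\mathcal{C}_b(\Omega,Y))=\mathcal{K}(X,\mathcal{C}_b(\Omega,Y))$, then the pair $(\ell_1(X), \mathcal{C}_b(\Omega,Y))$ has the BPBp.
   Context: Banach spaces are real or complex (all over the same scalar field). For a Banach space $X$, $B_X$ is the closed unit ball, $S_X$ the unit sphere, $X^*$ the topological dual. $\mathcal{L}(X,Y)$ is the Banach space of bounded linear operators from $X$ into $Y$ with the operator norm, and $\mathcal{K}(X,Y)$ is the subspace of compact operators, i.e. those $T$ for which $\overline{T(B_X)}$ is compact in $Y$. $\ell_1(X)$ is the Banach space of all sequences $(x_k)$ in $X$ with $\sum_{k=1}^\infty \|x_k\|$ convergent, normed by this sum. $\mathcal{C}_b(\Omega,Y)$ is the Banach space of all bounded continuous functions from $\Omega$ into $Y$, with the supremum norm. A convex series $\sum_{k=1}^\infty \alpha_k$ is a series with $\alpha_k \ge 0$ and $\sum_{k=1}^\infty \alpha_k = 1$. BPBp: a pair $(X,Y)$ of Banach spaces has the Bishop-Phelps-Bollobás property for operators (BPBp) if, given $\varepsilon>0$, there is $\eta(\varepsilon)>0$ such that for every $T\in S_{\mathcal{L}(X,Y)}$ and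 $x_0\in S_X$ with $\|Tx_0\|>1-\eta(\varepsilon)$, there exist $S\in S_{\mathcal{L}(X,Y)}$ and $u_0\in S_X$ such that $\|Su_0\|=1$, $\|u_0-x_0\|<\varepsilon$ and $\|S-T\|<\varepsilon$. Generalized AHSP: a pair $(X,Y)$ of Banach spaces has the generalized approximate hyperplane series property (generalized AHSP) if, for every $\varepsilon>0$, there exists $0<\eta(\varepsilon)<\varepsilon$ such that given sequences $(T_k)\subset S_{\mathcal{L}(X,Y)}$ and $(x_k)\subset S_X$, and a convex series $\sum_{k=1}^\infty\alpha_k$ such that $\left\|\sum_{k=1}^\infty \alpha_k T_k x_k\right\|>1-\eta(\varepsilon)$, there exist a subset $A\subset\mathbb{N}$, $y^*\in S_{Y^*}$, and sequences $(S_k)\subset S_{\mathcal{L}(X,Y)}$, $(z_k)\subset S_X$ satisfying: (1) $\sum_{k\in A}\alpha_k>1-\varepsilon$; (2) $\|z_k-x_k\|<\varepsilon$ and $\|S_k-T_k\|<\varepsilon$ for all $k\in A$; (3) $y^*(S_kz_k)=1$ for every $k\in A$. *)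

(* Defs.v *)
From HB Require Import structures.
From mathcomp Require Import all_boot all_order all_algebra.
From mathcomp Require Import complex.
From mathcomp Require Import all_classical all_reals all_analysis.

Set Implicit Arguments.
Unset Strict Implicit.
Unset Printing Implicit Defensive.

Import Order.TTheory GRing.Theory Num.Theory.
Import numFieldNormedType.Exports.

Local Open Scope classical_set_scope.
Local Open Scope ring_scope.

Inductive scalar_kind : Set := RealScalars | ComplexScalars.

(* On R[i], x <= y means that y - x is a nonnegative real number; hence norms
   (which MathComp-Analysis values in the scalar field) are nonnegative reals,
   and "0 < e" means that e is a positive real, in both cases. *)
Definition scalars (R : realType) (s : scalar_kind) : numFieldType :=
  match s with RealScalars => R | ComplexScalars => R[i] end.

Section order_completeness.
Context {R : realType} {s : scalar_kind}.
Local Notation K := (scalars R s).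

Lemma scalars_sup (A : set K) (M : K) : A !=set0 ->
  (forall a, A a -> 0 <= a) -> ubound A M -> exists m, supremums A m.
Proof.
move: A M; case: s => /= A M [a0 Aa0] A0 AM.
  have As : has_sup A by split; [exists a0|exists M].
  exists (sup A); split; first exact: sup_upper_bound.
  by move=> x Ax; apply: ge_sup => //; exists a0.
have Aim (a : R[i]) : A a -> complex.Im a = 0.
  by move=> /A0; rewrite lecE => /andP[/eqP + _].
have As : has_sup (@complex.Re R @` A).
  split; first by exists (complex.Re a0), a0.
  by exists (complex.Re M) => _ [a Aa <-]; move: (AM _ Aa); rewrite lecE => /andP[].
exists (sup (@complex.Re R @` A))%:C%C; split; [move=> a Aa|move=> x Ax].
  by rewrite lecE/= Aim// eqxx/=; apply: (sup_upper_bound As); exists a.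
move: (Ax _ Aa0); rewrite lecE (Aim a0)// => /andP[/eqP xim _].
rewrite lecE/= xim eqxx/=; apply: ge_sup; first exact: As.1.
by move=> _ [a Aa <-]; move: (Ax _ Aa); rewrite lecE => /andP[].
Qed.

Lemma nondecreasing_scalars_cvg (u : nat -> K) (M : K) : (forall n, 0 <= u n) ->
  {homo u : m n / (m <= n)%N >-> m <= n} -> (forall n, u n <= M) ->
  exists l, [/\ u @ \oo --> l, forall n, u n <= l &
    forall b, (forall n, u n <= b) -> l <= b].
Proof.
move=> u0 ul uM.
have [| | |l [lu lle]] := @scalars_sup (range u) M.
- by exists (u 0%N), 0%N.
- by move=> _ [n _ <-].
- by move=> _ [n _ <-].
have {}lu n : u n <= l by apply: lu; exists n.
have {}lle b : (forall n, u n <= b) -> l <= b.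
  by move=> ub; apply: lle => _ [n _ <-].
exists l; split => //; apply/cvgrPdist_lt => e e0.
have lR : l \is Num.real by rewrite ger0_real// (le_trans (u0 0%N)).
have [N uN] : exists N, l - e < u N.
  apply: contrapT => /forallNP H.
  suff : l <= l - e by rewrite lerDl oppr_ge0 => /(lt_le_trans e0); rewrite ltxx.
  apply: lle => n; rewrite real_leNgt; first exact/negP.
    by rewrite ger0_real.
  by rewrite rpredB// gtr0_real.
near=> n; rewrite ger0_norm ?subr_ge0// ltrBlDr -ltrBlDl.
apply: (lt_le_trans uN); apply: ul; near: n.
by exists N.
Unshelve. all: by end_near. Qed.

Lemma nneg_series_scalars_cvg (u : nat -> K) (M : K) : (forall n, 0 <= u n) ->
  (forall n, series u n <= M) ->
  [/\ cvgn (series u), forall n, series u n <= limn (series u) &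
    forall b, (forall n, series u n <= b) -> limn (series u) <= b].
Proof.
move=> u0 uM.
have [| |//|l [cl lu lle]] := @nondecreasing_scalars_cvg (series u) M.
- by move=> n; rewrite sumr_ge0.
- by move=> m n mn; rewrite -subr_ge0 sub_series_geq// sumr_ge0.
have -> : limn (series u) = l by apply: cvg_lim.
by split => //; apply/cvg_ex; exists l.
Qed.

Lemma cvg_nneg_series_scalars (u : nat -> K) : (forall n, 0 <= u n) ->
  cvgn (series u) -> exists M, forall n, series u n <= M.
Proof.
move=> u0 /cvg_seq_bounded/pinfty_ex_gt0[M _ uM]; exists M => n.
by rewrite -[leLHS]ger0_norm ?sumr_ge0//; exact: uM.
Qed.

End order_completeness.

Section supnorm.
Context {R : realType} {s : scalar_kind} {D : Type}.
Local Notation K := (scalars R s).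
Context {Y : normedModType K}.
Implicit Types (B : set D) (f g : D -> Y).

(* The supremum of |f| over B, and 0 when B is empty or f is unbounded on B. *)
Definition supnorm B f : K := supremum 0 [set `|f x| | x in B].

Lemma supnorm_spec B f M : (forall x, B x -> `|f x| <= M) ->
  [/\ 0 <= supnorm B f, forall x, B x -> `|f x| <= supnorm B f &
  forall b, 0 <= b -> (forall x, B x -> `|f x| <= b) -> supnorm B f <= b].
Proof.
move=> fM; rewrite /supnorm; set A := [set `|f x| | x in B].
have [B0|/set0P[x0 Bx0]] := eqVneq B set0.
  by rewrite /A B0 image_set0 supremum0; split.
have [| | |m Am] := @scalars_sup R s A M.
- by exists `|f x0|, x0.
- by move=> _ [x _ <-].
- by move=> _ [x Bx <-]; exact: fM.
rewrite /supremum ifF; last first.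
  by apply/negbTE/set0P; exists `|f x0|, x0.
case: xgetP => [_ -> {m Am}[uA lA]|/(_ _ Am)//]; split.
- by apply: (le_trans (normr_ge0 (f x0))); apply: uA; exists x0.
- by move=> x Bx; apply: uA; exists x.
- by move=> b _ fb; apply: lA => _ [x Bx <-]; exact: fb.
Qed.

Lemma supnormD B f g M N : (forall x, B x -> `|f x| <= M) ->
  (forall x, B x -> `|g x| <= N) ->
  supnorm B (f \+ g) <= supnorm B f + supnorm B g.
Proof.
move=> fM gN; have [f0 fu _] := supnorm_spec fM.
have [g0 gu _] := supnorm_spec gN.
have H x : B x -> `|(f \+ g) x| <= supnorm B f + supnorm B g.
  by move=> Bx; rewrite (le_trans (ler_normD _ _))// lerD ?fu ?gu.
by have [_ _] := supnorm_spec H; apply => //; rewrite addr_ge0.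
Qed.

Lemma supnormZ B f M (l : K) : (forall x, B x -> `|f x| <= M) ->
  supnorm B (l \*: f) = `|l| * supnorm B f.
Proof.
move=> fM; have [f0 fu fle] := supnorm_spec fM.
have H x : B x -> `|(l \*: f) x| <= `|l| * supnorm B f.
  by move=> Bx; rewrite /= normrZ ler_wpM2l// fu.
have [lf0 lfu lfle] := supnorm_spec H.
apply/eqP; rewrite eq_le lfle ?mulr_ge0//=.
have [l0|l0] := eqVneq l 0; first by rewrite [in leLHS]l0 normr0 mul0r.
rewrite -ler_pdivlMl ?normr_gt0//; apply: fle => [|x Bx].
  by rewrite mulr_ge0// invr_ge0.
by rewrite ler_pdivlMl ?normr_gt0// -normrZ lfu.
Qed.

Lemma supnorm_eq0 B f M : (forall x, B x -> `|f x| <= M) ->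
  supnorm B f = 0 -> forall x, B x -> f x = 0.
Proof.
move=> fM f0 x Bx; have [_ /(_ _ Bx)] := supnorm_spec fM.
by rewrite f0 normr_le0 => /eqP.
Qed.

End supnorm.

Definition unit_ball {K : numFieldType} (X : normedModType K) : set X :=
  [set x | `|x| <= 1].
Arguments unit_ball {K} X.

(* bounded_operator X Y is the space L(X, Y), bounded_continuous Omega Y is
   C_b(Omega, Y); the Lmodule_isNormed instances below give them (and ell1 X)
   their usual norms and the induced topology. *)
Section bounded_operators.
Context {R : realType} {s : scalar_kind}.
Local Notation K := (scalars R s).

Definition is_bounded_operator (X Y : normedModType K) : {pred X -> Y} :=
  [pred T | `[< linear T /\ exists M, forall x, `|T x| <= M * `|x| >]].

Record bounded_operator (X Y : normedModType K) := BoundedOperator {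
  operator_fun :> X -> Y ;
  _ : operator_fun \in @is_bounded_operator X Y }.

Context {X Y : normedModType K}.

HB.instance Definition _ := [isSub for @operator_fun X Y].
HB.instance Definition _ := [Choice of bounded_operator X Y by <:].

Lemma operator_linear (T : bounded_operator X Y) : linear T.
Proof. by case: T => T /= /asboolP[]. Qed.

HB.instance Definition _ (T : bounded_operator X Y) :=
  GRing.isLinear.Build K X Y _ T (operator_linear T).

Lemma operator_bounded (T : bounded_operator X Y) :
  exists2 M, 0 <= M & forall x, `|T x| <= M * `|x|.
Proof.
case: T => T /= /asboolP[_ [M TM]]; exists `|M| => // x.
have [x0|x0] := eqVneq `|x| 0; first by move: (TM x); rewrite x0 !mulr0.
have : M \is Num.real.
  have xg0 : 0 < `|x| by rewrite lt_neqAle eq_sym x0 normr_ge0.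
  rewrite ger0_real// -(pmulr_lge0 _ xg0).
  exact: le_trans (TM x).
move=> Mr; apply: (le_trans (TM x)); rewrite ler_wpM2r// real_ler_norm//.
Qed.

Lemma is_bounded_operator_submod : submod_closed (@is_bounded_operator X Y).
Proof.
split.
  apply/asboolP; split; first by move=> a x y /=; rewrite scaler0 addr0.
  by exists 0 => x; rewrite normr0 mul0r.
move=> a f g If Ig; pose F := BoundedOperator If; pose G := BoundedOperator Ig.
apply/asboolP; split.
  move=> b x y.
  change (a *: f (b *: x + y) + g (b *: x + y) =
    b *: (a *: f x + g x) + (a *: f y + g y)).
  have lf : linear f := operator_linear F; have lg : linear g := operator_linear G.
  rewrite lf lg !scalerDr !scalerA (mulrC a b).
  by rewrite !addrA; congr (_ + _); rewrite -!addrA; congr (_ + _); rewrite addrC.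
have [M M0 fM] := operator_bounded F; have [N N0 gN] := operator_bounded G.
exists (`|a| * M + N) => x; change (`|a *: f x + g x| <= (`|a| * M + N) * `|x|).
by rewrite (le_trans (ler_normD _ _))// mulrDl lerD// normrZ -mulrA ler_wpM2l.
Qed.

HB.instance Definition _ := GRing.isSubmodClosed.Build K (X -> Y)
  (@is_bounded_operator X Y) is_bounded_operator_submod.
HB.instance Definition _ :=
  [SubChoice_isSubLmodule of bounded_operator X Y by <:].

Lemma operator_bounded_unit_ball (T : bounded_operator X Y) :
  exists M, forall x, unit_ball X x -> `|T x| <= M.
Proof.
have [M M0 TM] := operator_bounded T; exists M => x x1.
by rewrite (le_trans (TM x))// -[leRHS]mulr1 ler_wpM2l.
Qed.

Definition operator_norm (T : bounded_operator X Y) : K :=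
  supnorm (unit_ball X) T.

Lemma operator_normD T U :
  operator_norm (T + U) <= operator_norm T + operator_norm U.
Proof.
have [M TM] := operator_bounded_unit_ball T.
have [N UN] := operator_bounded_unit_ball U.
exact: supnormD TM UN.
Qed.

Lemma operator_normZ (l : K) T : operator_norm (l *: T) = `|l| * operator_norm T.
Proof.
have [M TM] := operator_bounded_unit_ball T; exact: supnormZ TM.
Qed.

Lemma operator_norm_eq0 T : operator_norm T = 0 -> T = 0.
Proof.
have [M TM] := operator_bounded_unit_ball T => /(supnorm_eq0 TM) T0.
apply: val_inj; apply/funext => x /=.
have [->|x0] := eqVneq x 0; first by rewrite linear0.
apply: (scalerI (a := `|x|^-1)); first by rewrite invr_eq0 normr_eq0.
have -> : `|x|^-1 *: T x = T (`|x|^-1 *: x) by rewrite linearZ.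
by rewrite scaler0 T0// /unit_ball/= normrZ normfV normr_id mulVf ?normr_eq0.
Qed.

HB.instance Definition _ := Lmodule_isNormed.Build K (bounded_operator X Y)
  operator_normD operator_normZ operator_norm_eq0.

End bounded_operators.
Arguments bounded_operator {R s} X Y.

Section bounded_continuous_functions.
Context {R : realType} {s : scalar_kind}.
Local Notation K := (scalars R s).

Definition is_bounded_continuous (Omega : topologicalType)
    (Y : normedModType K) : {pred Omega -> Y} :=
  [pred f | `[< continuous f /\ bounded_fun f >]].

Record bounded_continuous (Omega : topologicalType) (Y : normedModType K) :=
  BoundedContinuous {
    bounded_continuous_fun :> Omega -> Y ;
    _ : bounded_continuous_fun \in @is_bounded_continuous Omega Y }.

Context {Omega : topologicalType} {Y : normedModType K}.

HB.instance Definition _ := [isSub for @bounded_continuous_fun Omega Y].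
HB.instance Definition _ := [Choice of bounded_continuous Omega Y by <:].

Lemma bounded_continuous_continuous (f : bounded_continuous Omega Y) :
  continuous f.
Proof. by case: f => f /= /asboolP[]. Qed.

Lemma bounded_continuous_bounded (f : bounded_continuous Omega Y) :
  exists M, forall t, [set: Omega] t -> `|f t| <= M.
Proof.
case: f => f /= /asboolP[_ /pinfty_ex_gt0[M _ fM]].
by exists M.
Qed.

Lemma bounded_fun_intro (f : Omega -> Y) (M : K) : 0 <= M ->
  (forall t, `|f t| <= M) -> bounded_fun f.
Proof.
move=> M0 fM; exists M; split; first exact: ger0_real.
by move=> N /ltW MN t _; exact: le_trans MN.
Qed.

Lemma is_bounded_continuous_submod :
  submod_closed (@is_bounded_continuous Omega Y).
Proof.
split.
  apply/asboolP; split; first by move=> t; exact: cvg_cst.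
  by apply: (@bounded_fun_intro _ 0) => // t; rewrite normr0.
move=> a f g /asboolP[cf bf] /asboolP[cg bg]; apply/asboolP; split.
  by move=> t; apply: cvgD; [apply: cvgZr; exact: cf|exact: cg].
have /pinfty_ex_gt0[M M0 fM] := bf; have /pinfty_ex_gt0[N N0 gN] := bg.
apply: (@bounded_fun_intro _ (`|a| * M + N)).
  by rewrite addr_ge0 ?mulr_ge0// ltW.
move=> t; rewrite (le_trans (ler_normD _ _))// lerD ?gN//.
by rewrite normrZ ler_wpM2l// fM.
Qed.

HB.instance Definition _ := GRing.isSubmodClosed.Build K (Omega -> Y)
  (@is_bounded_continuous Omega Y) is_bounded_continuous_submod.
HB.instance Definition _ :=
  [SubChoice_isSubLmodule of bounded_continuous Omega Y by <:].

Definition bounded_continuous_norm (f : bounded_continuous Omega Y) : K :=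
  supnorm [set: Omega] f.

Lemma bounded_continuous_normD f g :
  bounded_continuous_norm (f + g) <=
  bounded_continuous_norm f + bounded_continuous_norm g.
Proof.
have [M fM] := bounded_continuous_bounded f.
have [N gN] := bounded_continuous_bounded g.
exact: supnormD fM gN.
Qed.

Lemma bounded_continuous_normZ (l : K) f :
  bounded_continuous_norm (l *: f) = `|l| * bounded_continuous_norm f.
Proof.
have [M fM] := bounded_continuous_bounded f; exact: supnormZ fM.
Qed.

Lemma bounded_continuous_norm_eq0 f : bounded_continuous_norm f = 0 -> f = 0.
Proof.
have [M fM] := bounded_continuous_bounded f => /(supnorm_eq0 fM) f0.
by apply: val_inj; apply/funext => t; exact: f0.
Qed.

HB.instance Definition _ :=
  Lmodule_isNormed.Build K (bounded_continuous Omega Y)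
    bounded_continuous_normD bounded_continuous_normZ
    bounded_continuous_norm_eq0.

End bounded_continuous_functions.
Arguments bounded_continuous {R s} Omega Y.

Section bounded_continuous_complete.
Context {R : realType} {s : scalar_kind}.
Local Notation K := (scalars R s).
Context {Omega : topologicalType} {Y : completeNormedModType K}.
Local Notation C := (bounded_continuous Omega Y).

Lemma bounded_continuous_norm_ge (f : C) t : `|f t| <= `|f|.
Proof.
have [M fM] := bounded_continuous_bounded f.
by have [_ + _] := supnorm_spec fM; apply.
Qed.

Lemma bounded_continuous_norm_le (f : C) M : 0 <= M ->
  (forall t, `|f t| <= M) -> `|f| <= M.
Proof.
move=> M0 fM; have [_ _] : [/\ _, _ & _] := supnorm_spec (fun t (_ : setT t) => fM t).
by apply.
Qed.

Lemma bounded_continuous_complete (F : set_system C) :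
  ProperFilter F -> cauchy F -> cvg F.
Proof.
move=> FF /cauchy_ballP Fc.
have {}Fc e : 0 < e -> \forall f & g \near F, `|f - g| < e.
  by move=> /Fc; rewrite -ball_normE.
have Fct t : cvg ((fun f : C => f t) @ F).
  apply: cauchy_cvg; apply/cauchy_ballP => e /Fc.
  move=> H; rewrite near_map2 -ball_normE; apply: filterS H => -[f g] /=.
  by apply: le_lt_trans; exact: (bounded_continuous_norm_ge (f - g)).
pose l t := lim ((fun f : C => f t) @ F).
have Fl e : 0 < e -> \forall f \near F, forall t, `|(f : C) t - l t| <= e.
  move=> e0; have e20 : 0 < e / 2 by rewrite divr_gt0.
  near=> f => t; near F => g.
  rewrite -(subrKA (g t)) (splitr e) (le_trans (ler_normD _ _))// lerD//.
    apply: (le_trans (bounded_continuous_norm_ge (f - g) t)); apply: ltW.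
    by near: g; near: f; apply: nearP_dep; exact: Fc.
  rewrite distrC; near: g.
  by apply: cvgr_dist_le => //; exact: Fct.
have cl : continuous l.
  move=> t; apply/cvgrPdist_le => e e0; have e30 : 0 < e / 3 by rewrite divr_gt0.
  near F => f.
  have fl : forall t, `|f t - l t| <= e / 3 by near: f; exact: Fl.
  near=> u.
  have -> : l t - l u = (l t - f t) + ((f t - f u) + (f u - l u)).
    by rewrite !subrKA.
  have -> : e = e / 3 + (e / 3 + e / 3).
    rewrite -!mulrDl -mulr2n -mulrS -[e in RHS]mulr1 -mulrnAr -mulrA.
    by rewrite divff ?mulr1// pnatr_eq0.
  rewrite (le_trans (ler_normD _ _))// lerD//; first by rewrite distrC.
  rewrite (le_trans (ler_normD _ _))// lerD//.
  by near: u; apply: cvgr_dist_le => //; exact: bounded_continuous_continuous.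
have bl : bounded_fun l.
  near F => f; apply: (@bounded_fun_intro _ _ _ _ _ (1 + `|f|)) => [|t].
    by rewrite addr_ge0.
  rewrite -[l t](subrK (f t)) (le_trans (ler_normD _ _))// lerD//.
    by rewrite distrC; move: t; near: f; exact: Fl.
  exact: bounded_continuous_norm_ge.
have Il : l \in @is_bounded_continuous _ _ Omega Y by apply/asboolP.
apply/cvg_ex; exists (BoundedContinuous Il); apply/cvgrPdist_le => e e0.
near=> f; rewrite distrC; apply: bounded_continuous_norm_le; first exact: ltW.
by near: f; exact: Fl.
Unshelve. all: by end_near. Qed.

HB.instance Definition _ :=
  Uniform_isComplete.Build C bounded_continuous_complete.

End bounded_continuous_complete.

Section summable_sequences.
Context {R : realType} {s : scalar_kind}.
Local Notation K := (scalars R s).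

Definition is_ell1 (X : normedModType K) : {pred nat -> X} :=
  [pred x : nat -> X | `[< cvgn (series (fun k => `|x k| : K)) >]].

Record ell1 (X : normedModType K) := Ell1 {
  ell1_fun :> nat -> X ;
  _ : ell1_fun \in @is_ell1 X }.

Context {X : normedModType K}.

HB.instance Definition _ := [isSub for @ell1_fun X].
HB.instance Definition _ := [Choice of ell1 X by <:].

Lemma ell1_cvg (x : ell1 X) : cvgn (series (fun k => `|x k| : K)).
Proof. by case: x => x /= /asboolP. Qed.

Lemma is_ell1P (x : nat -> X) :
  (exists M, forall n, series (fun k => `|x k|) n <= M) <-> x \in @is_ell1 X.
Proof.
split=> [[M xM]|/asboolP xc].
  by apply/asboolP; have [] := nneg_series_scalars_cvg _ xM.
by apply: cvg_nneg_series_scalars.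
Qed.

Lemma is_ell1_submod : submod_closed (@is_ell1 X).
Proof.
split.
  apply/is_ell1P; exists 0 => n; rewrite /series/= big1// => i _.
  by rewrite normr0.
move=> a f g /is_ell1P[M fM] /is_ell1P[N gN]; apply/is_ell1P.
exists (`|a| * M + N) => n; rewrite (@le_trans _ _
  (`|a| * series (fun k => `|f k|) n + series (fun k => `|g k|) n))//.
  rewrite /series/= mulr_sumr -big_split/=; apply: ler_sum => i _.
  by rewrite (le_trans (ler_normD _ _))// normrZ.
by rewrite lerD// ler_wpM2l.
Qed.

HB.instance Definition _ := GRing.isSubmodClosed.Build K (nat -> X)
  (@is_ell1 X) is_ell1_submod.
HB.instance Definition _ := [SubChoice_isSubLmodule of ell1 X by <:].

Definition ell1_norm (x : ell1 X) : K := limn (series (fun k => `|x k| : K)).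

Lemma ell1_norm_ge x n : series (fun k => `|ell1_fun x k|) n <= ell1_norm x.
Proof.
have [M xM] : exists M, forall n, series (fun k => `|x k|) n <= M.
  by apply/is_ell1P; case: x.
by have [_ + _] := nneg_series_scalars_cvg (fun=> normr_ge0 _) xM; apply.
Qed.

Lemma ell1_norm_le x b : (forall n, series (fun k => `|ell1_fun x k|) n <= b) ->
  ell1_norm x <= b.
Proof.
move=> xb; have [_ _] := nneg_series_scalars_cvg (fun=> normr_ge0 _) xb.
exact.
Qed.

Lemma ell1_norm_term x k : `|ell1_fun x k| <= ell1_norm x.
Proof.
apply: le_trans (ell1_norm_ge x k.+1).
by rewrite /series/= big_nat_recr//= lerDr sumr_ge0.
Qed.

Lemma ell1_norm_ge0 x : 0 <= ell1_norm x.
Proof. exact: le_trans (ell1_norm_term x 0). Qed.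

Lemma ell1_normD x y : ell1_norm (x + y) <= ell1_norm x + ell1_norm y.
Proof.
apply: ell1_norm_le => n.
apply: (le_trans _ (lerD (ell1_norm_ge x n) (ell1_norm_ge y n))).
rewrite /series/= -big_split/=; apply: ler_sum => i _; exact: ler_normD.
Qed.

Lemma ell1_normZ_le (l : K) x : ell1_norm (l *: x) <= `|l| * ell1_norm x.
Proof.
apply: ell1_norm_le => n.
apply: (le_trans _ (ler_wpM2l (normr_ge0 l) (ell1_norm_ge x n))).
rewrite /series/= mulr_sumr; apply: ler_sum => i _.
by rewrite -normrZ.
Qed.

Lemma ell1_normZ (l : K) x : ell1_norm (l *: x) = `|l| * ell1_norm x.
Proof.
apply/eqP; rewrite eq_le ell1_normZ_le/=.
have [l0|l0] := eqVneq l 0.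
  by rewrite [in leLHS]l0 normr0 mul0r ell1_norm_ge0.
rewrite -ler_pdivlMl ?normr_gt0// -normfV.
by rewrite -[in leLHS](scalerK l0 x) ell1_normZ_le.
Qed.

Lemma ell1_norm_eq0 x : ell1_norm x = 0 -> x = 0.
Proof.
move=> x0; apply: val_inj; apply/funext => k /=.
by apply/eqP; rewrite -normr_le0 -x0; exact: ell1_norm_term.
Qed.

HB.instance Definition _ := Lmodule_isNormed.Build K (ell1 X)
  ell1_normD ell1_normZ ell1_norm_eq0.

End summable_sequences.
Arguments ell1 {R s} X.

Section ell1_complete.
Context {R : realType} {s : scalar_kind}.
Local Notation K := (scalars R s).
Context {X : completeNormedModType K}.
Local Notation L := (ell1 X).

Lemma ell1_complete (F : set_system L) : ProperFilter F -> cauchy F -> cvg F.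
Proof.
move=> FF /cauchy_ballP Fc.
have {}Fc e : 0 < e -> \forall f & g \near F, `|f - g| < e.
  by move=> /Fc; rewrite -ball_normE.
have Fck k : cvg ((fun f : L => f k) @ F).
  apply: cauchy_cvg; apply/cauchy_ballP => e /Fc.
  move=> H; rewrite near_map2 -ball_normE; apply: filterS H => -[f g] /=.
  by apply: le_lt_trans; exact: (ell1_norm_term (f - g)).
pose l k := lim ((fun f : L => f k) @ F).
have Fs n : series (fun k => `|(g : L) k - l k|) n @[g --> F] --> (0 : K).
  elim: n => [|n IHn].
    under eq_cvg do rewrite /series/= big_nil.
    exact: cvg_cst.
  under eq_cvg do rewrite seriesSr.
  have : `|(g : L) n - l n| @[g --> F] --> `|l n - l n|.
    by apply: cvg_norm; apply: cvgB; [exact: Fck|exact: cvg_cst].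
  by rewrite subrr normr0 => /(cvgD IHn); rewrite addr0.
have Fse n e : 0 < e ->
    \forall g \near F, series (fun k => `|(g : L) k - l k|) n <= e.
  move=> e0; have /cvgr_dist_le/(_ _ e0) := Fs n; apply: filterS => g.
  by rewrite sub0r normrN ger0_norm// sumr_ge0.
have Fl e : 0 < e -> \forall f \near F,
    forall n, series (fun k => `|(f : L) k - l k|) n <= e.
  move=> e0; have e20 : 0 < e / 2 by rewrite divr_gt0.
  near=> f => n; near F => g.
  apply: (@le_trans _ _ (series (fun k => `|f k - g k|) n +
                         series (fun k => `|g k - l k|) n)).
    rewrite /series/= -big_split/=; apply: ler_sum => k _.
    by rewrite -(subrKA (g k)) ler_normD.
  rewrite [leRHS]splitr lerD//.
    apply: (le_trans (ell1_norm_ge (f - g) n)); apply: ltW.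
    by near: g; near: f; apply: nearP_dep; exact: Fc.
  by near: g; exact: Fse.
have Il : l \in @is_ell1 _ _ X.
  apply/is_ell1P; near F => f; exists (1 + `|f|) => n.
  apply: (@le_trans _ _ (series (fun k => `|f k - l k|) n +
                         series (fun k => `|f k|) n)).
    rewrite /series/= -big_split/=; apply: ler_sum => k _.
    by rewrite -[l k](subrK (f k)) (le_trans (ler_normD _ _))// subrK distrC.
  rewrite lerD//; last exact: (ell1_norm_ge f).
  by move: n; near: f; exact: Fl.
apply/cvg_ex; exists (Ell1 Il); apply/cvgrPdist_le => e e0.
near=> f; rewrite distrC; apply: ell1_norm_le.
by near: f; exact: Fl.
Unshelve. all: by end_near. Qed.

HB.instance Definition _ := Uniform_isComplete.Build L ell1_complete.

End ell1_complete.

Definition dual {R : realType} {s : scalar_kind}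
  (X : normedModType (scalars R s)) := bounded_operator X (scalars R s)^o.

Definition compact_operator {R : realType} {s : scalar_kind}
    {X Y : normedModType (scalars R s)} (T : bounded_operator X Y) :=
  compact (closure [set T x | x in unit_ball X]).

Section properties.
Context {R : realType} {s : scalar_kind}.
Local Notation K := (scalars R s).

(* As alpha k >= 0, the alpha k are real also when K is complex. *)
Definition convex_series (alpha : nat -> K) :=
  (forall k, 0 <= alpha k) /\ series alpha @ \oo --> (1 : K).

Definition BPBp (X Y : completeNormedModType K) :=
  forall eps : K, 0 < eps -> exists2 eta : K, 0 < eta &
    forall (T : bounded_operator X Y) (x0 : X),
      `|T| = 1 -> `|x0| = 1 -> `|T x0| > 1 - eta ->
      exists (S : bounded_operator X Y) (u0 : X),
        [/\ `|S| = 1, `|u0| = 1, `|S u0| = 1, `|u0 - x0| < eps &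
            `|S - T| < eps].

Definition generalized_AHSP (X Y : completeNormedModType K) :=
  forall eps : K, 0 < eps -> exists2 eta : K, 0 < eta < eps &
    forall (T : nat -> bounded_operator X Y) (x : nat -> X) (alpha : nat -> K),
      (forall k, `|T k| = 1) -> (forall k, `|x k| = 1) ->
      convex_series alpha ->
      `|limn (series (fun k => alpha k *: T k (x k)))| > 1 - eta ->
      exists (A : set nat) (ys : dual Y)
             (S : nat -> bounded_operator X Y) (z : nat -> X),
        [/\ `|ys| = 1, forall k, `|S k| = 1 & forall k, `|z k| = 1] /\
        [/\ limn (series (fun k => \1_A k * alpha k)) > 1 - eps,
            forall k, A k -> `|z k - x k| < eps /\ `|S k - T k| < eps &
            forall k, A k -> ys (S k (z k)) = 1].

End properties.

(* Main.v *)
Require Import Defs.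
From HB Require Import structures.
From mathcomp Require Import all_boot all_order all_algebra.
From mathcomp Require Import complex.
From mathcomp Require Import all_classical all_reals all_analysis.

(** Both implications come from one localisation argument. Suppose that an
    operator [T] into C_b(Omega, Y) (or a convex combination of values of such
    operators) almost attains its norm. A sup norm is almost attained at some
    point [t0], so the operator [x |-> T x t0] into [Y] almost attains its norm,
    and after normalisation the hypothesis on [Y] gives a nearby operator [S]
    into [Y] with the exact norm attainment that is wanted. It remains to bring
    [S] back to an operator into C_b(Omega, Y) that is close to [T] and whose
    value at [t0] is [S]; attainment at [t0] then forces its norm to be 1, and
    functionals on [Y] are transported by composing with the evaluation at [t0].

    The way back is [patch_operator]. As [T] is compact, the image of the unit
    ball is equicontinuous, so the operators [x |-> T x t] depend on [t]
    continuously for the operator norm; all of them are close to [S] when [t] is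
    in a neighbourhood of [t0]. Complete regularity gives a continuous [phi]
    between 0 and 1 that equals 1 at [t0] and vanishes off this neighbourhood,
    and
      [U x t = phi t *: S x + (1 - phi t) *: T x t]
    is the required operator: convexity keeps its norm bounded, and
    [U x t - T x t = phi t *: (S x - T x t)] is small everywhere.

    On l_1(X) operators need not be compact, and the neighbourhoods found on the
    coordinates may shrink to [t0]. But an operator on l_1(X) is nothing but a
    bounded sequence of operators on [X], and its norm is the supremum of theirs
    ([ell1_operator_exists], [ell1_operator_norm_le]). So the coordinates can be
    patched one at a time, each with its own [phi] ([ell1_patch_operator]); this
    proves the statement on the Bishop-Phelps-Bollobas property directly,
    without its equivalence with the generalized AHSP.

    For the generalized AHSP there are infinitely many operators at once, and
    some [x |-> T_k x t0] may be far from norm 1, or even vanish. Because the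
    value at [t0] of the convex combination of the [T_k x_k] has norm almost 1,
    these indices carry little weight, by Markov's inequality
    ([convex_series_markov]), and they are removed from the set [A]. *)

Set Implicit Arguments.
Unset Strict Implicit.
Unset Printing Implicit Defensive.

Import Order.TTheory GRing.Theory Num.Theory.
Import numFieldNormedType.Exports.

Local Open Scope classical_set_scope.
Local Open Scope ring_scope.

(** * Positive scalars, series and bump functions *)

Section scalar_facts.
Context {R : realType} {s : scalar_kind}.
Local Notation K := (scalars R s).

(** The order on [K] is partial when [K] is complex, so [Num.min] is of no use
    here; positive elements are comparable nevertheless. *)
Lemma pos_lower_bound (a b : K) : 0 < a -> 0 < b ->
  exists c : K, [/\ 0 < c, c <= a & c <= b].
Proof.
move=> a0 b0; have := real_comparable (gtr0_real a0) (gtr0_real b0).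
by case/orP => ab; [exists a|exists b]; split.
Qed.

Lemma exists_half_lt (e : K) : 0 < e -> exists2 d : K, 0 < d & d + d < e.
Proof.
move=> e0; exists (e / 2 / 2); first by rewrite !divr_gt0.
by rewrite -splitr [ltRHS]splitr ltrDl divr_gt0.
Qed.

Lemma norm_limn_le (V : normedModType K) (u : nat -> V) (M : K) :
  cvgn u -> (forall n, `|u n| <= M) -> `|limn u| <= M.
Proof.
move=> cu uM; apply/ler_addgt0Pr => e e0.
have /cvgr_dist_le/(_ _ e0)[n _ /(_ n (leqnn n)) un] := cu.
by rewrite -[limn u](subrK (u n)) (le_trans (ler_normD _ _))// addrC lerD.
Qed.

Lemma abs_summable_cvg (V : completeNormedModType K) (u : nat -> V) :
  cvgn (series (fun k => `|u k| : K)) -> cvgn (series u).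
Proof.
move=> uc; apply/cauchy_cvgP/cauchy_seriesP => e.
move: uc => /cvg_cauchy/cauchy_seriesP/[apply].
apply: filterS => n /=; rewrite ger0_norm ?sumr_ge0//.
by apply: le_lt_trans; apply: ler_norm_sum.
Qed.

(** When the scalars are complex, a separating function with values in [R] is
    composed with the inclusion of [R]. *)
Lemma scalar_bump (Omega : topologicalType) (t0 : Omega) (U : set Omega) :
  completely_regular_space Omega -> nbhs t0 U ->
  exists phi : Omega -> K, [/\ continuous phi, phi t0 = 1,
    forall t, 0 <= phi t <= 1 & forall t, phi t != 0 -> U t].
Proof.
move=> cr t0U; have : uniform_separator [set t0] (~` U°).
  apply: cr; first exact/open_closedC/open_interior.
  by move=> /= H; apply: H; exact: nbhs_singleton (nbhs_interior t0U).
move=> /(@uniform_separatorP _ R)[f [cf f01 /= f0 f1]].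
pose g t := 1 - f t.
have g01 t : 0 <= g t <= 1.
  have /= := f01 (f t) (ex_intro2 _ _ t I erefl).
  by rewrite in_itv/= /g subr_ge0 lerBlDr lerDl => /andP[-> ->].
have gt0 : g t0 = 1 by rewrite /g (f0 (f t0)) ?subr0//; exists t0.
have gU t : g t != 0 -> U t.
  move=> gt; apply: contrapT => Ut.
  move/eqP: gt; apply; rewrite /g (f1 (f t)) ?subrr//.
  by exists t => // /interior_subset.
have cg : continuous g by move=> t; apply: cvgB; [exact: cvg_cst|exact: cf].
case: s; first by exists g.
exists (fun t => (g t)%:C%C); split => //=.
- move=> t; apply/cvgrPdist_lt => e.
  rewrite ltcE => /andP[/eqP ei er].
  have /cvgrPdist_lt/(_ _ er) := cg t; apply: filterS => u gu.
  by rewrite -rmorphB normc_def/= expr0n addr0 sqrtr_sqr ltcE ei eqxx.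
- by rewrite gt0.
- by move=> t; rewrite !ler0c lecR; exact: g01.
- by move=> t gt; apply: gU; apply: contra_neq gt => ->.
Qed.

End scalar_facts.

(** * Norms of operators and evaluations at a point *)

Section operators.
Context {R : realType} {s : scalar_kind}.
Local Notation K := (scalars R s).

Section basic.
Context {X Y : normedModType K}.
Implicit Types T U : bounded_operator X Y.

Lemma operatorBE T U x : (T - U) x = T x - U x.
Proof. by []. Qed.

Lemma operator0E x : (0 : bounded_operator X Y) x = 0.
Proof. by []. Qed.

Lemma operator_le_norm T x : `|T x| <= `|T| * `|x|.
Proof.
have [->|x0] := eqVneq x 0; first by rewrite linear0 !normr0 mulr0.
have [M TM] := operator_bounded_unit_ball T.
have [_ /(_ (`|x|^-1 *: x)) + _] := supnorm_spec TM.
rewrite /unit_ball/= linearZ/= !normrZ normfV normr_id mulVf ?normr_eq0//.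
move=> /(_ (lexx _)).
by rewrite mulrC ler_pdivrMr ?normr_gt0.
Qed.

Lemma operator_norm_le_ball T M : 0 <= M ->
  (forall x, `|x| <= 1 -> `|T x| <= M) -> `|T| <= M.
Proof.
move=> M0 TM; have [N TN] := operator_bounded_unit_ball T.
by have [_ _] := supnorm_spec TN; apply.
Qed.

Lemma operator_norm_le T M : 0 <= M -> (forall x, `|T x| <= M * `|x|) ->
  `|T| <= M.
Proof.
move=> M0 TM; apply: operator_norm_le_ball => // x x1.
by rewrite (le_trans (TM x))// -[leRHS]mulr1 ler_wpM2l.
Qed.

Lemma operator_le1 T x : `|T| <= 1 -> `|T x| <= `|x|.
Proof. by move=> T1; rewrite (le_trans (operator_le_norm T x))// ler_piMl. Qed.

Lemma operator_norm_eq1 T x : `|T| <= 1 -> `|x| = 1 -> 1 <= `|T x| -> `|T| = 1.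
Proof.
move=> T1 x1 Tx; apply/eqP; rewrite eq_le T1/= (le_trans Tx)//.
by rewrite (le_trans (operator_le_norm T x))// x1 mulr1.
Qed.

Lemma linear_bounded_operator (f : X -> Y) M : linear f ->
  (forall x, `|f x| <= M * `|x|) -> f \in @is_bounded_operator R s X Y.
Proof. by move=> fl fM; apply/asboolP; split=> //; exists M. Qed.

Lemma operator_continuous T : continuous T.
Proof.
move=> x; apply/cvgrPdist_lt => e e0.
have T0 : 0 < `|T| + 1 by rewrite ltr_wpDl.
near=> y; rewrite -linearB (le_lt_trans (operator_le_norm _ _))//.
rewrite (@le_lt_trans _ _ ((`|T| + 1) * `|x - y|))//.
  by rewrite ler_wpM2r// lerDl.
rewrite -ltr_pdivlMl// mulrC; near: y; apply: cvgr_dist_lt => //.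
by rewrite divr_gt0.
Unshelve. all: by end_near. Qed.

Lemma exists_normalized_operator T : T != 0 ->
  exists U : bounded_operator X Y, `|U| = 1.
Proof.
move=> T0; exists (`|T|^-1 *: T).
by rewrite normrZ normfV normr_id mulVf// normr_eq0.
Qed.

(** The operator [U] only serves when [T = 0], where any operator of norm 1 is
    at distance [1 - `|T|]; otherwise [T] is rescaled. *)
Lemma normalize_operator T U : `|U| = 1 -> `|T| <= 1 ->
  exists2 V : bounded_operator X Y, `|V| = 1 & `|V - T| <= 1 - `|T|.
Proof.
move=> U1 T1; have [T0|T0] := eqVneq `|T| 0.
  by exists U => //; rewrite (normr0_eq0 T0) subr0 U1 normr0 subr0.
exists (`|T|^-1 *: T); first by rewrite normrZ normfV normr_id mulVf.
rewrite -[X in _ - X]scale1r -scalerBl normrZ ger0_norm; last first.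
  by rewrite subr_ge0 invf_ge1// lt_neqAle eq_sym T0 normr_ge0.
by rewrite mulrBl mulVf// mul1r.
Qed.

End basic.

Section composition.
Context {X Y Z : normedModType K}.

Lemma is_bounded_operator_comp (U : bounded_operator Y Z)
  (T : bounded_operator X Y) : U \o T \in @is_bounded_operator R s X Z.
Proof.
apply: (@linear_bounded_operator _ _ _ (`|U| * `|T|)).
  by move=> a x y /=; rewrite !linearP.
move=> x /=; rewrite (le_trans (operator_le_norm U (T x)))// -mulrA.
by rewrite ler_wpM2l// operator_le_norm.
Qed.

Definition operator_comp (U : bounded_operator Y Z) (T : bounded_operator X Y) :
  bounded_operator X Z := BoundedOperator (is_bounded_operator_comp U T).

Lemma operator_comp_norm_le U T : `|operator_comp U T| <= `|U| * `|T|.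
Proof.
apply: operator_norm_le => [|x]; first by rewrite mulr_ge0.
rewrite (le_trans (operator_le_norm U (T x)))// -mulrA.
by rewrite ler_wpM2l// operator_le_norm.
Qed.

End composition.

Section evaluation.
Context {Omega : topologicalType} {Y : completeNormedModType K}.
Local Notation C := (bounded_continuous Omega Y).

Lemma is_bounded_operator_eval (t : Omega) :
  (fun f : C => f t) \in @is_bounded_operator R s C Y.
Proof.
apply: (@linear_bounded_operator _ _ _ 1) => [a f g //|f].
by rewrite mul1r; exact: bounded_continuous_norm_ge.
Qed.

Definition evaluation (t : Omega) : bounded_operator C Y :=
  BoundedOperator (is_bounded_operator_eval t).

Lemma evaluation_norm_le1 t : `|evaluation t| <= 1.
Proof.
apply: operator_norm_le => // f; rewrite mul1r.
exact: bounded_continuous_norm_ge.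
Qed.

Lemma is_bounded_continuous_cst (y : Y) :
  (fun=> y) \in @is_bounded_continuous R s Omega Y.
Proof.
apply/asboolP; split; first by move=> t; exact: cvg_cst.
exact: (@bounded_fun_intro _ _ _ _ _ `|y|).
Qed.

(** Constant functions lift every vector of [Y] to one of the same norm, so
    composing with an evaluation cannot shrink a functional. *)
Lemma dual_evaluation_norm (t : Omega) (ys : dual Y) :
  `|operator_comp ys (evaluation t)| = `|ys|.
Proof.
apply/eqP; rewrite eq_le; apply/andP; split.
  rewrite (le_trans (operator_comp_norm_le _ _))// ler_piMr//.
  exact: evaluation_norm_le1.
apply: operator_norm_le => // y.
pose c : C := BoundedContinuous (is_bounded_continuous_cst y).
rewrite (le_trans (operator_le_norm (operator_comp ys (evaluation t)) c))//.
by rewrite ler_wpM2l//; exact: bounded_continuous_norm_le.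
Qed.

(** The hypothesis [0 <= r] excludes the case of an empty [Omega], where every
    [f] has norm 0 and there is no point to choose. *)
Lemma exists_near_norm (f : C) (r : K) : 0 <= r -> r < `|f| ->
  exists t, r < `|f t|.
Proof.
move=> r0 rf; apply: contrapT => /forallNP H.
have rR : r \is Num.real by rewrite ger0_real.
suff /(lt_le_trans rf) : `|f| <= r by rewrite ltxx.
apply: bounded_continuous_norm_le => // t.
by rewrite real_leNgt ?normr_real//; apply/negP; exact: H.
Qed.

End evaluation.
End operators.

(** * Patching a compact operator at a point *)

Section patching.
Context {R : realType} {s : scalar_kind}.
Local Notation K := (scalars R s).
Context {X : normedModType K} {Y : completeNormedModType K}.
Context {Omega : topologicalType}.
Local Notation C := (bounded_continuous Omega Y).

(** A compact set of functions is equicontinuous at [t0]: near each member [f]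
    of the closure of the image of the unit ball, functions vary by at most [e]
    on a neighbourhood of [t0] that depends on [f], and compactness makes one
    neighbourhood suit all of them. *)
Lemma compact_operator_equicontinuous (T : bounded_operator X C) t0 (e : K) :
  compact_operator T -> 0 < e ->
  \forall t \near t0,
    `|operator_comp (evaluation t) T - operator_comp (evaluation t0) T| <= e.
Proof.
move=> /compact_near_coveringP cT e0.
have e30 : 0 < e / 3 by rewrite divr_gt0.
pose P (t : Omega) (g : C) := `|g t - g t0| <= e.
have cover : forall f, closure [set T x | x in unit_ball X] f ->
    \forall g \near f & t \near t0, P t g.
  move=> f _.
  exists (ball f (e / 3), [set t | `|f t - f t0| <= e / 3]).
    split => /=; first exact: nbhsx_ballx.
    have := @bounded_continuous_continuous _ _ _ _ f t0.
    move=> /cvgr_dist_le/(_ _ e30); apply: filterS => t.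
    by rewrite distrC.
  move=> [g t] /=; rewrite -ball_normE/= => -[fg ft].
  have fgt u : `|g u - f u| <= e / 3.
    rewrite distrC ltW// (le_lt_trans _ fg)//.
    exact: (bounded_continuous_norm_ge (f - g)).
  rewrite /P -(subrKA (f t)) -(subrKA (f t0) (f t)).
  have -> : e = e / 3 + (e / 3 + e / 3).
    rewrite -!mulrDl -mulr2n -mulrS -[e in RHS]mulr1 -mulrnAr -mulrA.
    by rewrite divff ?mulr1// pnatr_eq0.
  rewrite (le_trans (ler_normD _ _))// lerD//.
  rewrite (le_trans (ler_normD _ _))// lerD//.
  by rewrite distrC.
have := cT Omega (nbhs t0) P (nbhs_filter t0) cover.
apply: filterS => t Tt.
apply: operator_norm_le_ball => [|x x1]; first exact: ltW.
by apply: Tt; apply: subset_closure; exists x.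
Qed.

(** The operator [U] interpolates between [S] at [t0] and [T] away from [t0], by
    means of a bump function supported where [x |-> T x t] is within [r] of
    [S]. *)
Lemma patch_operator (T : bounded_operator X C) (S : bounded_operator X Y)
    (t0 : Omega) (M r : K) :
  completely_regular_space Omega -> compact_operator T ->
  `|T| <= M -> `|S| <= M -> `|S - operator_comp (evaluation t0) T| < r ->
  exists U : bounded_operator X C,
    [/\ `|U| <= M, operator_comp (evaluation t0) U = S & `|U - T| <= r].
Proof.
move=> cr cT TM SM STr.
have M0 : 0 <= M by apply: le_trans TM.
have r0 : 0 <= r by apply: le_trans (ltW STr).
have := compact_operator_equicontinuous t0 cT.
move=> /(_ (r - `|S - operator_comp (evaluation t0) T|)).
rewrite subr_gt0 => /(_ STr) near_t0.
have [phi [cphi phi1 phi01 phiU]] := @scalar_bump R s _ _ _ cr near_t0.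
have Tt x t : `|T x t| <= M * `|x|.
  rewrite (le_trans (bounded_continuous_norm_ge _ _))//.
  by rewrite (le_trans (operator_le_norm T x))// ler_wpM2r.
have Sx x : `|S x| <= M * `|x|.
  by rewrite (le_trans (operator_le_norm S x))// ler_wpM2r.
(* A convex combination of [S x] and [T x t] at each [t]: hence [FM]. *)
pose F x t := phi t *: S x + (1 - phi t) *: T x t.
have FM x t : `|F x t| <= M * `|x|.
  have /andP[p0 p1] := phi01 t.
  rewrite (le_trans (ler_normD _ _))// !normrZ (ger0_norm p0).
  rewrite ger0_norm ?subr_ge0//.
  have -> : M * `|x| = phi t * (M * `|x|) + (1 - phi t) * (M * `|x|).
    by rewrite -mulrDl addrC subrK mul1r.
  by rewrite lerD// ler_wpM2l// subr_ge0.
have FC x : F x \in @is_bounded_continuous R s Omega Y.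
  apply/asboolP; split; last first.
    by apply: (@bounded_fun_intro _ _ _ _ _ (M * `|x|)) => //; rewrite mulr_ge0.
  move=> t; apply: cvgD; apply: cvgZ; first exact: cphi.
  - exact: cvg_cst.
  - by apply: cvgB; [exact: cvg_cst|exact: cphi].
  - exact: bounded_continuous_continuous.
have UP : (fun x => BoundedContinuous (FC x)) \in @is_bounded_operator R s X C.
  apply: (@linear_bounded_operator _ _ _ _ _ M) => [a x y|x]; last first.
    by apply: bounded_continuous_norm_le => [|t]; [rewrite mulr_ge0|exact: FM].
  apply: val_inj; apply/funext => t.
  change (F (a *: x + y) t = a *: F x t + F y t).
  rewrite /F (operator_linear S) (operator_linear T).
  change (phi t *: (a *: S x + S y) + (1 - phi t) *: (a *: T x t + T y t) =
    a *: (phi t *: S x + (1 - phi t) *: T x t) +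
    (phi t *: S y + (1 - phi t) *: T y t)).
  rewrite !scalerDr !scalerA addrACA; congr (_ + _).
  by rewrite (mulrC a (phi t)) (mulrC a).
exists (BoundedOperator UP); split.
- apply: operator_norm_le => // x.
  by apply: bounded_continuous_norm_le => [|t]; [rewrite mulr_ge0|exact: FM].
- apply: val_inj; apply/funext => x.
  change (F x t0 = S x).
  by rewrite /F phi1 subrr scale0r addr0 scale1r.
- apply: operator_norm_le => // x.
  apply: bounded_continuous_norm_le => [|t]; first by rewrite mulr_ge0.
  change (`|F x t - T x t| <= r * `|x|).
  have -> : F x t - T x t = phi t *: (S x - T x t).
    by rewrite /F scalerBl scale1r addrA addrAC addrK scalerBr.
  have /andP[p0 p1] := phi01 t.
  have [pt|/phiU/= Ut] := eqVneq (phi t) 0.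
    by rewrite pt scale0r normr0 mulr_ge0.
  rewrite normrZ (ger0_norm p0) (@le_trans _ _ `|S x - T x t|) ?ler_piMl//.
  have -> : S x - T x t = (S - operator_comp (evaluation t) T) x by [].
  rewrite (le_trans (operator_le_norm _ _))// ler_wpM2r//.
  rewrite -(subrKA (operator_comp (evaluation t0) T)).
  rewrite (le_trans (ler_normD _ _))// -lerBrDl distrC; exact: Ut.
Qed.

End patching.

(** * Operators on l_1(X) *)

Section ell1_operators.
Context {R : realType} {s : scalar_kind}.
Local Notation K := (scalars R s).

Section embedding.
Context {X : normedModType K}.

Definition single (k : nat) (x : X) : nat -> X :=
  fun j => if j == k then x else 0.

Lemma series_single_norm k x n :
  series (fun j => `|single k x j| : K) n <= `|x|.
Proof.
rewrite /series/= (eq_bigr (fun j => if j == k then `|x| else 0)); last first.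
  by move=> j _; rewrite /single; case: ifP => // _; rewrite normr0.
by rewrite -big_mkcond/= big_nat1_eq; case: ifP.
Qed.

Lemma is_ell1_single k x : single k x \in @is_ell1 R s X.
Proof. by apply/is_ell1P; exists `|x|; exact: series_single_norm. Qed.

Lemma is_bounded_operator_single k :
  (fun x => Ell1 (is_ell1_single k x)) \in @is_bounded_operator R s X (ell1 X).
Proof.
apply: (@linear_bounded_operator _ _ _ _ _ 1) => [a x y|x].
  apply: val_inj; apply/funext => j.
  change (single k (a *: x + y) j = a *: single k x j + single k y j).
  by rewrite /single; case: ifP => // _; rewrite scaler0 addr0.
by rewrite mul1r; apply: ell1_norm_le => n; exact: series_single_norm.
Qed.

Definition ell1_embedding (k : nat) : bounded_operator X (ell1 X) :=
  BoundedOperator (is_bounded_operator_single k).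

Lemma ell1_embedding_norm_le1 k : `|ell1_embedding k| <= 1.
Proof.
apply: operator_norm_le => // x; rewrite mul1r.
by apply: ell1_norm_le => n; exact: series_single_norm.
Qed.

Lemma ell1_partial_sumE (w : ell1 X) n j :
  (series (fun k => ell1_embedding k (w k)) n : ell1 X) j =
  if (j < n)%N then w j else 0.
Proof.
elim: n => [|n IHn]; first by rewrite /series/= big_geq.
rewrite seriesSr.
change ((series (fun k => ell1_embedding k (w k)) n : ell1 X) j +
  single n (w n) j = if (j < n.+1)%N then w j else 0).
rewrite IHn /single ltnS [(j <= n)%N]leq_eqVlt.
by case: ltngtP => [jn|jn|->]; rewrite ?addr0 ?add0r.
Qed.

Lemma ell1_series_cvg (w : ell1 X) :
  series (fun k => ell1_embedding k (w k)) @ \oo --> w.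
Proof.
(* The norm of l_1(X) is additive on sequences of disjoint supports. *)
have tail n : `|w - series (fun k => ell1_embedding k (w k)) n| <=
    `|w| - series (fun k => `|w k|) n.
  apply: ell1_norm_le => m.
  rewrite lerBrDr.
  have [mn|/ltnW nm] := leqP m n.
    rewrite [X in X + _](_ : _ = 0) ?add0r; first exact: (ell1_norm_ge w).
    rewrite /series/= big_nat big1// => j /andP[_ jm].
    change (`|w j -
      (series (fun k => ell1_embedding k (w k)) n : ell1 X) j| = 0).
    by rewrite ell1_partial_sumE (leq_trans jm mn) subrr normr0.
  apply: le_trans (ell1_norm_ge w m).
  rewrite -[leRHS](subrK (series (fun k => `|w k|) n)) lerD2r.
  rewrite sub_series_geq// /series/= (@big_cat_nat _ _ _ n)//=.
  rewrite big_nat big1 ?add0r => [|j /andP[_ jn]]; last first.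
    change (`|w j -
      (series (fun k => ell1_embedding k (w k)) n : ell1 X) j| = 0).
    by rewrite ell1_partial_sumE jn subrr normr0.
  rewrite big_nat [leRHS]big_nat ler_sum// => j /andP[nj _].
  change (`|w j -
    (series (fun k => ell1_embedding k (w k)) n : ell1 X) j| <= `|w j|).
  by rewrite ell1_partial_sumE ltnNge nj subr0.
apply/cvgrPdist_le => e e0.
have /cvgr_dist_le/(_ _ e0) := @ell1_cvg _ _ _ w; apply: filterS => n wn.
apply: le_trans (tail n) (le_trans _ wn).
by rewrite ger0_norm// subr_ge0; exact: (ell1_norm_ge w).
Qed.

(** Linear combinations of the embedded copies of [X] are dense, and a norm
    estimate on each copy adds up because the norm of l_1(X) is a sum. *)
Lemma ell1_operator_norm_le (Z : normedModType K)
    (T : bounded_operator (ell1 X) Z) M :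
  0 <= M -> (forall k, `|operator_comp T (ell1_embedding k)| <= M) -> `|T| <= M.
Proof.
move=> M0 TM; apply: operator_norm_le => // w.
have Tw : T (series (fun k => ell1_embedding k (w k)) n) @[n --> \oo] --> T w.
  exact: cvg_comp (@ell1_series_cvg w) (@operator_continuous _ _ _ _ T w).
rewrite -(cvg_lim _ Tw)//; apply: norm_limn_le.
  by apply/cvg_ex; exists (T w).
move=> n; rewrite /series/= linear_sum (le_trans (ler_norm_sum _ _ _))//.
apply: (@le_trans _ _ (M * series (fun k => `|w k|) n)); last first.
  by rewrite ler_wpM2l//; exact: (ell1_norm_ge w).
rewrite /series/= mulr_sumr ler_sum// => k _.
have := operator_le_norm (operator_comp T (ell1_embedding k)) (w k).
by move=> /le_trans; apply; rewrite ler_wpM2r.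
Qed.

Lemma ell1_operator_ext (Z : normedModType K)
    (T U : bounded_operator (ell1 X) Z) :
  (forall k, operator_comp T (ell1_embedding k) =
             operator_comp U (ell1_embedding k)) -> T = U.
Proof.
move=> TU; apply/eqP; rewrite -subr_eq0 -normr_le0.
apply: ell1_operator_norm_le => // k.
apply: operator_norm_le => // x.
have TUx : T (ell1_embedding k x) = U (ell1_embedding k x).
  exact: (congr1 (fun V : bounded_operator X Z => V x) (TU k)).
change (`|T (ell1_embedding k x) - U (ell1_embedding k x)| <= 0 * `|x|).
by rewrite TUx subrr normr0 mul0r.
Qed.

End embedding.

(** The universal property of l_1(X): a bounded sequence of operators on [X]
    into a complete space extends, the value at [u] being the absolutely
    convergent series of the [S k (u k)]. *)
Lemma ell1_operator_exists {X : normedModType K} {Z : completeNormedModType K}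
    (S : nat -> bounded_operator X Z) M : (forall k, `|S k| <= M) ->
  exists2 T : bounded_operator (ell1 X) Z, `|T| <= M &
    forall k, operator_comp T (ell1_embedding k) = S k.
Proof.
move=> SM; have M0 : 0 <= M by apply: le_trans (SM 0).
have Su (u : ell1 X) n : series (fun k => `|S k (u k)| : K) n <= M * `|u|.
  apply: (@le_trans _ _ (M * series (fun k => `|u k|) n)); last first.
    by rewrite ler_wpM2l//; exact: (ell1_norm_ge u).
  rewrite /series/= mulr_sumr ler_sum// => k _.
  by rewrite (le_trans (operator_le_norm _ _))// ler_wpM2r.
have cS (u : ell1 X) : cvgn (series (fun k => S k (u k))).
  apply: abs_summable_cvg.
  by have [] := nneg_series_scalars_cvg (fun=> normr_ge0 _) (Su u).
pose F (u : ell1 X) := limn (series (fun k => S k (u k))).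
have FM u : `|F u| <= M * `|u|.
  apply: norm_limn_le => // n; apply: le_trans (Su u n).
  exact: ler_norm_sum.
have Flin : linear F.
  move=> a u v; apply: cvg_lim => //.
  have -> : series (fun k => S k ((a *: u + v : ell1 X) k)) =
      (fun n => a *: series (fun k => S k (u k)) n +
                series (fun k => S k (v k)) n).
    apply/funext => n; rewrite /series/= scaler_sumr -big_split/=.
    by apply: eq_bigr => k _; rewrite -(operator_linear (S k)).
  by apply: cvgD; [apply: cvgZr; exact: cS|exact: cS].
exists (BoundedOperator (linear_bounded_operator Flin FM)).
  exact: operator_norm_le.
move=> k; apply: val_inj; apply/funext => x; apply: lim_near_cst => //.
exists k.+1 => // n /= kn.
rewrite /series/= (eq_bigr (fun j => if j == k then S k x else 0)).
  by rewrite -big_mkcond/= big_nat1_eq kn.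
by move=> j _; rewrite /single; case: eqP => [->//|_]; rewrite linear0.
Qed.

(** Compactness is only asked of the restrictions to the coordinates: they are
    patched separately, each with its own bump function, and reassembled with
    the same bounds on the norms. *)
Lemma ell1_patch_operator {X : normedModType K} {Y : completeNormedModType K}
    {Omega : topologicalType}
    (T : bounded_operator (ell1 X) (bounded_continuous Omega Y))
    (S : bounded_operator (ell1 X) Y) (t0 : Omega) (M r : K) :
  completely_regular_space Omega ->
  (forall k, compact_operator (operator_comp T (ell1_embedding k))) ->
  `|T| <= M -> `|S| <= M -> `|S - operator_comp (evaluation t0) T| < r ->
  exists U : bounded_operator (ell1 X) (bounded_continuous Omega Y),
    [/\ `|U| <= M, operator_comp (evaluation t0) U = S & `|U - T| <= r].
Proof.
move=> cr cT TM SM STr.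
have r0 : 0 <= r by apply: le_trans (ltW STr).
have comp_le (Z : normedModType K) (V : bounded_operator (ell1 X) Z) k :
    `|operator_comp V (ell1_embedding k)| <= `|V|.
  rewrite (le_trans (operator_comp_norm_le _ _))// ler_piMr//.
  exact: ell1_embedding_norm_le1.
have : forall k, exists U : bounded_operator X (bounded_continuous Omega Y),
    [/\ `|U| <= M,
        operator_comp (evaluation t0) U = operator_comp S (ell1_embedding k) &
        `|U - operator_comp T (ell1_embedding k)| <= r].
  move=> k; apply: patch_operator => //.
  - exact: le_trans TM.
  - exact: le_trans SM.
  - apply: le_lt_trans STr.
    exact: (comp_le _ (S - operator_comp (evaluation t0) T) k).
move=> /choice[V VP].
have [|U UM UV] := @ell1_operator_exists _ _ V M.
  by move=> k; have [] := VP k.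
exists U; split => //.
- apply: ell1_operator_ext => k; have [_ <- _] := VP k.
  by rewrite -UV; exact: val_inj.
- apply: ell1_operator_norm_le => // k; have [_ _] := VP k.
  by rewrite -UV.
Qed.

End ell1_operators.

(** * Convex series *)

Section convex.
Context {R : realType} {s : scalar_kind}.
Local Notation K := (scalars R s).
Implicit Types alpha beta gamma : nat -> K.

Lemma convex_series_le1 alpha n : convex_series alpha -> series alpha n <= 1.
Proof.
move=> [a0 a1]; have ca : cvgn (series alpha) by apply/cvg_ex; exists (1 : K).
have [M aM] := cvg_nneg_series_scalars a0 ca.
by have [_ + _] := nneg_series_scalars_cvg a0 aM; rewrite (cvg_lim _ a1).
Qed.

Lemma series_le_convex alpha beta n : convex_series alpha ->
  (forall k, beta k <= alpha k) -> series beta n <= 1.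
Proof.
move=> ca ba; apply: le_trans (convex_series_le1 n ca).
by rewrite /series/= ler_sum.
Qed.

Lemma convex_series_cvg (V : completeNormedModType K) alpha (v : nat -> V) :
  convex_series alpha -> (forall k, `|v k| <= 1) ->
  cvgn (series (fun k => alpha k *: v k)).
Proof.
move=> ca v1; have [a0 _] := ca; apply: abs_summable_cvg.
have v_le1 n : series (fun k => `|alpha k *: v k| : K) n <= 1.
  apply: (series_le_convex _ ca) => k.
  by rewrite normrZ (ger0_norm (a0 k)) ler_piMr.
by have [] := nneg_series_scalars_cvg (fun=> normr_ge0 _) v_le1.
Qed.

(** A convex series of vectors whose sum has norm close to 1 must, on average,
    have terms of norm close to 1: with [beta] a bound on the norms,
    [sum alpha * beta] dominates the norm of the sum, and the weights [alpha]
    add up to 1. *)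
Lemma convex_series_deficit (V : completeNormedModType K) alpha (v : nat -> V)
    beta n : convex_series alpha -> (forall k, `|v k| <= beta k <= 1) ->
  series (fun k => alpha k * (1 - beta k)) n <=
    1 - `|limn (series (fun k => alpha k *: v k))|.
Proof.
move=> ca vb; have [a0 a1] := ca.
have b0 k : 0 <= beta k by have /andP[+ _] := vb k; apply: le_trans.
have b1 k : beta k <= 1 by have /andP[] := vb k.
have g0 k : 0 <= alpha k * (1 - beta k) by rewrite mulr_ge0// subr_ge0.
have ab0 k : 0 <= alpha k * beta k by rewrite mulr_ge0.
have ab_le1 m : series (fun k => alpha k * beta k) m <= 1.
  by apply: (series_le_convex _ ca) => k; rewrite ler_piMr.
have g_le1 m : series (fun k => alpha k * (1 - beta k)) m <= 1.
  by apply: (series_le_convex _ ca) => k; rewrite ler_piMr// lerBlDr lerDl.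
have [cb bl _] := nneg_series_scalars_cvg ab0 ab_le1.
have [cg gl _] := nneg_series_scalars_cvg g0 g_le1.
apply: (le_trans (gl n)).
have -> : limn (series (fun k => alpha k * (1 - beta k))) =
    1 - limn (series (fun k => alpha k * beta k)).
  apply: cvg_lim => //.
  have -> : series (fun k => alpha k * (1 - beta k)) =
      (fun m => series alpha m - series (fun k => alpha k * beta k) m).
    apply/funext => m; rewrite /series/= -sumrB.
    by apply: eq_bigr => k _; rewrite mulrBr mulr1.
  exact: cvgB.
rewrite lerD2l lerN2; apply: norm_limn_le.
  apply: convex_series_cvg => // k.
  by have /andP[+ _] := vb k; move/le_trans; apply.
move=> m; apply: le_trans (bl m); rewrite (le_trans (ler_norm_sum _ _ _))//.
rewrite /series/= ler_sum// => k _; rewrite normrZ (ger0_norm (a0 k)).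
by rewrite ler_wpM2l//; have /andP[] := vb k.
Qed.

(** Markov's inequality for the weights [alpha]: the indices with [d <= gamma k]
    have total weight at most [D / d], so deleting them from [A] costs no
    more. *)
Lemma convex_series_markov alpha gamma (A : set nat) (d D : K) :
  convex_series alpha -> (forall k, 0 <= gamma k) -> 0 < d ->
  (forall n, series (fun k => alpha k * gamma k) n <= D) ->
  limn (series (fun k => \1_A k * alpha k)) <=
  limn (series (fun k => \1_(A `&` [set k | gamma k < d]) k * alpha k)) + D / d.
Proof.
move=> ca g0 d0 gD; have [a0 _] := ca.
have ind B : [/\ cvgn (series (fun k => \1_B k * alpha k)),
    forall n, series (fun k => \1_B k * alpha k) n <=
      limn (series (fun k => \1_B k * alpha k)) &
    forall b, (forall n, series (fun k => \1_B k * alpha k) n <= b) ->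
      limn (series (fun k => \1_B k * alpha k)) <= b].
  apply: (@nneg_series_scalars_cvg R s _ 1) => [k|n].
    by rewrite mulr_ge0// indicE.
  apply: (series_le_convex _ ca) => k.
  by rewrite ler_piMl// indicE lern1 leq_b1.
have [_ _] := ind A; apply => n.
set B := A `&` _; have [_ + _] := ind B.
move=> /(_ n) Bn.
apply: (@le_trans _ _ (series (fun k => \1_B k * alpha k) n +
    series (fun k => alpha k * gamma k) n / d)); last first.
  by rewrite lerD// ler_pM2r ?invr_gt0.
rewrite /series/= mulr_suml -big_split/= ler_sum// => k _.
have agd : 0 <= alpha k * gamma k / d by rewrite !mulr_ge0// invr_ge0 ltW.
rewrite !indicE.
have [Bk|nBk] := boolP (k \in B).
  rewrite mul1r; apply: (@le_trans _ _ (alpha k)); last by rewrite lerDl.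
  by rewrite ler_piMl// lern1 leq_b1.
rewrite mul0r add0r; have [Ak|nAk] := boolP (k \in A); last by rewrite mul0r.
rewrite mul1r -mulrA ler_peMr// ler_pdivlMr// mul1r.
rewrite (real_leNgt (gtr0_real d0) (ger0_real (g0 k))).
apply: contra nBk => gk; rewrite inE; split => //.
by move: Ak; rewrite inE.
Qed.

End convex.

(** * Transfer from Y to C_b(Omega, Y) *)

Section transfer.
Context {R : realType} {s : scalar_kind}.
Local Notation K := (scalars R s).
Context {X Y : completeNormedModType K} {Omega : topologicalType}.
Local Notation C := (bounded_continuous Omega Y).

Lemma BPBp_ell1_bounded_continuous :
  completely_regular_space Omega ->
  (forall T : bounded_operator X C, compact_operator T) ->
  BPBp (ell1 X) Y -> BPBp (ell1 X) C.
Proof.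
move=> cr cpt bpb eps eps0.
have [d d0 dd] := exists_half_lt eps0.
have [eta eta0 Heta] := bpb d d0.
have [h h0 hh] := exists_half_lt eta0.
(* The bound [eta] on the defect of norm attainment is spent twice, once for
   the norm of [T] at [t0] and once for the normalisation: hence the half. *)
have [a [a0 ad ah]] := pos_lower_bound d0 h0.
have [b [b0 ba b1]] := pos_lower_bound a0 ltr01.
exists b => // T x0 T1 x01 Tx0.
have [t0 Tt0] : exists t, 1 - b < `|T x0 t|.
  by apply: exists_near_norm => //; rewrite subr_ge0.
set V := operator_comp (evaluation t0) T.
have Vx0 : 1 - b < `|V x0| by [].
have V1 : `|V| <= 1.
  rewrite (le_trans (operator_comp_norm_le _ _))// T1 mulr1.
  exact: evaluation_norm_le1.
have bV : 1 - b < `|V|.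
  by rewrite (lt_le_trans Vx0)// (le_trans (operator_le_norm _ _))// x01 mulr1.
have Vn0 : V != 0.
  by rewrite -normr_gt0 (le_lt_trans _ bV)// subr_ge0.
have [U0 U01] := exists_normalized_operator Vn0.
have [U U1 UV] := normalize_operator U01 V1.
have {}UV : `|U - V| < b by rewrite (le_lt_trans UV)// ltrBlDl -ltrBlDr.
have Ux0 : 1 - eta < `|U x0|.
  have : `|V x0| <= `|U x0| + b.
    rewrite -[V x0](subrK (U x0)) addrC (le_trans (ler_normD _ _))// lerD2l.
    rewrite distrC -operatorBE (le_trans (operator_le_norm _ _))// x01 mulr1.
    exact: ltW.
  move/(lt_le_trans Vx0); rewrite -ltrBlDr; apply: le_lt_trans.
  rewrite -addrA -opprD lerD2l lerN2 (le_trans _ (ltW hh))//.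
  by rewrite lerD// (le_trans ba).
have [S [u0 [S1 u01 Su0 ux SU]]] := Heta U x0 U1 x01 Ux0.
have SV : `|S - V| < d + d.
  rewrite -(subrKA U) (le_lt_trans (ler_normD _ _))// ltrD//.
  by rewrite (lt_le_trans UV)// (le_trans ba).
have cptT k : compact_operator (operator_comp T (ell1_embedding k)) := cpt _.
have TM : `|T| <= 1 by rewrite T1.
have SM : `|S| <= 1 by rewrite S1.
have [W [W1 WS WT]] := ell1_patch_operator cr cptT TM SM SV.
have Wu : 1 <= `|W u0|.
  rewrite -Su0 -WS; exact: (bounded_continuous_norm_ge (W u0)).
have W1e : `|W| = 1 by apply: operator_norm_eq1 Wu.
exists W, u0; split => //.
- by apply/eqP; rewrite eq_le Wu andbT -u01 operator_le1.
- by rewrite (lt_trans ux)// (le_lt_trans _ dd)// lerDl ltW.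
- exact: le_lt_trans WT dd.
Qed.

Lemma generalized_AHSP_bounded_continuous :
  completely_regular_space Omega ->
  (forall T : bounded_operator X C, compact_operator T) ->
  generalized_AHSP X Y -> generalized_AHSP X C.
Proof.
move=> cr cpt ahsp eps eps0.
have [d d0 dd] := exists_half_lt eps0.
have [eta1 /andP[eta10 eta1d] Heta] := ahsp d d0.
have d_eps : d < eps by rewrite (lt_trans _ dd)// ltrDl.
have [h h0 hh] := exists_half_lt eta10.
have dd0 : 0 < d * d by rewrite mulr_gt0.
(* [eta <= d * d] makes the deleted weight [eta / d] at most [d]; [eta <= h]
   pays for the defect at [t0] and for the normalisation of the [V k]. *)
have [a [a0 add ah]] := pos_lower_bound dd0 h0.
have [eta [eta0 etaa le_eta1]] := pos_lower_bound a0 ltr01.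
have eta_h : eta <= h by exact: le_trans ah.
exists eta.
  rewrite eta0 (le_lt_trans eta_h)// (lt_trans _ d_eps)//.
  by rewrite (lt_trans _ eta1d)// (lt_trans _ hh)// ltrDl.
move=> T x alpha T1 x1 ca Tx.
have [t0] : exists t,
    1 - eta < `|limn (series (fun k => alpha k *: T k (x k))) t|.
  by apply: exists_near_norm => //; rewrite subr_ge0.
pose V k := operator_comp (evaluation t0) (T k).
have V1 k : `|V k| <= 1.
  rewrite (le_trans (operator_comp_norm_le _ _))// T1 mulr1.
  exact: evaluation_norm_le1.
have -> : limn (series (fun k => alpha k *: T k (x k))) t0 =
    limn (series (fun k => alpha k *: V k (x k))).
  apply/esym/cvg_lim => //.
  have cT : cvgn (series (fun k => alpha k *: T k (x k))).
    apply: convex_series_cvg => // k.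
    by rewrite (le_trans (operator_le_norm _ _))// T1 x1 mulr1.
  suff -> : series (fun k => alpha k *: V k (x k)) =
      evaluation t0 \o series (fun k => alpha k *: T k (x k)).
    exact: cvg_comp cT (@operator_continuous _ _ _ _ (evaluation t0) _).
  apply/funext => n; rewrite [RHS]/comp /series.
  by rewrite (linear_sum (evaluation t0)).
move=> Vx.
have VxV k : `|V k (x k)| <= `|V k| <= 1.
  by rewrite V1 andbT (le_trans (operator_le_norm _ _))// x1 mulr1.
(* Some [V k] must be nonzero, or L(X, Y) might have no operator of norm 1. *)
have [k0 Vk0] : exists k, V k != 0.
  apply: contrapT => /forallNP V0.
  move: Vx; rewrite (_ : series _ = fun=> 0); last first.
    apply/funext => n; apply: big1 => k _.
    by have /negP/negPn/eqP -> := V0 k; rewrite operator0E scaler0.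
  by rewrite lim_cst// normr0 subr_lt0 => /(le_lt_trans le_eta1); rewrite ltxx.
have [U0 U01] := exists_normalized_operator Vk0.
have : forall k, exists U : bounded_operator X Y,
    `|U| = 1 /\ `|U - V k| <= 1 - `|V k|.
  by move=> k; have [U] := normalize_operator U01 (V1 k); exists U.
move=> /choice[U /all_and2[U1 UV]].
have deficit n : series (fun k => alpha k * (1 - `|V k|)) n <= eta.
  apply: le_trans (convex_series_deficit n ca VxV) _.
  by rewrite lerBlDl -lerBlDr ltW.
have [a0' _] := ca.
have Ux : 1 - eta1 < `|limn (series (fun k => alpha k *: U k (x k)))|.
  have cU : cvgn (series (fun k => alpha k *: U k (x k))).
    apply: convex_series_cvg => // k.
    by rewrite (le_trans (operator_le_norm _ _))// U1 x1 mulr1.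
  have cV : cvgn (series (fun k => alpha k *: V k (x k))).
    apply: convex_series_cvg => // k.
    by have /andP[+ _] := VxV k; move/le_trans; apply.
  have UVx : `|limn (series (fun k => alpha k *: V k (x k))) -
               limn (series (fun k => alpha k *: U k (x k)))| <= eta.
    rewrite -limB//; apply: norm_limn_le => [|n]; first exact: is_cvgB.
    apply: le_trans (deficit n).
    rewrite [X in `|X|](_ : _ = \sum_(0 <= k < n)
      (alpha k *: V k (x k) - alpha k *: U k (x k))); last by rewrite sumrB.
    rewrite (le_trans (ler_norm_sum _ _ _))// ler_sum// => k _.
    rewrite -scalerBr normrZ (ger0_norm (a0' k)) ler_wpM2l// distrC -operatorBE.
    by rewrite (le_trans (operator_le_norm _ _))// x1 mulr1.
  have := ler_normD (limn (series (fun k => alpha k *: V k (x k))) -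
               limn (series (fun k => alpha k *: U k (x k))))
               (limn (series (fun k => alpha k *: U k (x k)))).
  rewrite subrK => /(lt_le_trans Vx).
  move/lt_le_trans => /(_ _ (lerD UVx (lexx _))).
  rewrite -ltrBlDl; apply: le_lt_trans.
  rewrite -addrA -opprD lerD2l lerN2 (le_trans _ (ltW hh))//.
  by rewrite lerD.
have [A [ys [S [z [[ys1 S1 z1] [wA near_A ysA]]]]]] :=
  Heta U x alpha U1 x1 ca Ux.
(* Patching needs [S k] close to [V k], whereas [S k] is close to [U k]; on [G]
   the normalisation moved [V k] by less than [d]. *)
pose G := [set k | 1 - `|V k| < d].
have : forall k, exists W : bounded_operator X C, `|W| = 1 /\
    ((A `&` G) k -> W (z k) t0 = S k (z k) /\ `|W - T k| < eps).
  move=> k; have [[Ak Gk]|nAG] := pselect ((A `&` G) k); last by exists (T k).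
  have [_ SU] := near_A k Ak.
  have cptT : compact_operator (T k) := cpt _.
  have TM : `|T k| <= 1 by rewrite T1.
  have SM : `|S k| <= 1 by rewrite S1.
  have SV : `|S k - V k| < d + d.
    rewrite -(subrKA (U k)) (le_lt_trans (ler_normD _ _))// ltrD//.
    exact: le_lt_trans (UV k) Gk.
  have [W [W1 WS WT]] := patch_operator cr cptT TM SM SV.
  have Wz : W (z k) t0 = S k (z k) by rewrite -WS.
  exists W; split; last by split => //; exact: le_lt_trans WT dd.
  apply: (operator_norm_eq1 W1 (z1 k)).
  apply: le_trans (bounded_continuous_norm_ge _ t0); rewrite Wz.
  have : `|ys (S k (z k))| <= `|S k (z k)| by apply: operator_le1; rewrite ys1.
  by rewrite (ysA k Ak) normr1.
move=> /choice[W /all_and2[W1 WP]].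
exists (A `&` G), (operator_comp ys (evaluation t0)), W, z; split.
  by split => //; rewrite dual_evaluation_norm.
split.
- have gamma0 k : 0 <= 1 - `|V k| by rewrite subr_ge0.
  have := convex_series_markov A ca gamma0 d0 deficit.
  have eta_d : eta / d <= d by rewrite ler_pdivrMr// (le_trans etaa).
  move=> /le_trans/(_ (lerD (lexx _) eta_d))/(lt_le_trans wA).
  rewrite -ltrBlDr; apply: lt_trans.
  by rewrite -addrA -opprD ltrD2l ltrN2.
- move=> k AGk; split; last by have [] := WP k AGk.
  have [Ak _] := AGk; have [zx _] := near_A k Ak.
  by rewrite (lt_trans zx)// (le_lt_trans _ dd)// lerDl ltW.
- move=> k AGk; have [Ak _] := AGk; have [Wz _] := WP k AGk.
  by rewrite -(ysA k Ak) -Wz.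
Qed.

End transfer.

Theorem theorem2p5 (R : realType) (s : scalar_kind)
    (X Y : completeNormedModType (scalars R s)) (Omega : topologicalType) :
  completely_regular_space Omega ->
  (forall T : bounded_operator X (bounded_continuous Omega Y),
     compact_operator T) ->
  (generalized_AHSP X Y -> generalized_AHSP X (bounded_continuous Omega Y)) /\
  (BPBp (ell1 X) Y -> BPBp (ell1 X) (bounded_continuous Omega Y)).
Proof.
move=> cr cpt; split.
  exact: generalized_AHSP_bounded_continuous.
exact: BPBp_ell1_bounded_continuous.
Qed.
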